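(* Let $m,n,\ell\ge0$ be integers such that $n+\ell\ge m$, and let $N\ge 0$. (a) The map $\theta:=f^{\ell+1}$ (the $(\ell+1)$-fold iterate of $f$) is a bijection \[\theta:\overline{\mathcal R}_{m,n}^{\ge 1-\ell}(N)\to \mathcal P_{m-\ell-1,n+\ell+1}(N-\ell-1)\] that preserves the Durfee rectangle, i.e. $\mathrm{dr}(\theta(\lambda))=\mathrm{dr}(\lambda)$. (b) The map $f^\ell$ is a bijection \[f^\ell:\overline{\mathcal R}_{m,n}^{\ge 1-\ell}(N)\to \overline{\mathcal R}_{m-\ell,n+\ell}^{\ge 1}(N-\ell)\] that preserves the Durfee square and the Durfee rectangle, i.e. $d(f^\ell(\lambda))=d(\lambda)$ and $\mathrm{dr}(f^\ell(\lambda))=\mathrm{dr}(\lambda)$.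
   Context: A partition $\lambda=(\lambda_1\ge\lambda_2\ge\dots\ge\lambda_k)$ is a weakly decreasing (possibly empty) sequence of positive integers; $|\lambda|=\sum_i\lambda_i$; $\lambda_i=0$ for $i>k$. The conjugate $\lambda'$ has parts $\lambda'_j=|\{i:\lambda_i\ge j\}|$. Let $d(\lambda)=\max\{i\ge1:\lambda_i\ge i\}$ be the side of the Durfee square ($0$ if $\lambda=\emptyset$), and $\mathrm{dr}(\lambda)=\max\{i\ge1:\lambda_i\ge i+1\}$ the height of the Durfee rectangle ($0$ if no such $i$). For $1\le i\le d(\lambda)$, the $i$th successive rank is $r_i(\lambda)=\lambda_i-\lambda'_i$. $\mathcal P_{m,n}(N)$ is the set of partitions of $N$ with at most $m$ parts and largest part at most $n$ (empty if $m$, $n$ or $N$ is negative). $\overline{\mathcal R}^{\ge b}$ is the set of partitions having at least one rank $r_i(\lambda)<b$ (so the empty partition is not in it), and $\overline{\mathcal R}^{\ge b}_{m,n}(N)=\overline{\mathcal R}^{\ge b}\cap\mathcal P_{m,n}(N)$. The map $f$ is defined on $\overline{\mathcal R}^{\ge 1}$ (partitions with some rank $\le 0$), with values in the set of all partitions, as follows. Given $\lambda\in\overline{\mathcal R}^{\ge1}$, let $i$ be the largest index in $\{1,\dots,d(\lambda)\}$ that minimizes $r_i(\lambda)$. Remove one part of size $i$ from $\lambda$ (such a part always exists); then add a part of size $i-1$ to the conjugate of the resulting partition (nothing is added if $i=1$), i.e. insert a column of height $i-1$ in the Young diagram. The resulting partition is $f(\lambda)$. *)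

(* Defs.v *)
From mathcomp Require Import all_boot all_order all_algebra.

Set Implicit Arguments.
Unset Strict Implicit.
Unset Printing Implicit Defensive.

Import Order.TTheory GRing.Theory Num.Theory.

(* Partitions are weakly decreasing sequences of positive natural numbers,
   indexed from 1: part la i is the i-th part, and is 0 for i > size la. *)
Definition is_partition (la : seq nat) : bool :=
  sorted geq la && all (fun x => 0 < x) la.

Definition part (la : seq nat) (i : nat) : nat := nth 0 la i.-1.

Definition conj_part (la : seq nat) (j : nat) : nat := count (leq j) la.

Definition conjugate (la : seq nat) : seq nat :=
  [seq conj_part la j | j <- iota 1 (part la 1)].

(* An empty \max is 0, which is the convention for d and dr. *)
Definition durfee (la : seq nat) : nat :=
  \max_(1 <= i < (size la).+1 | i <= part la i) i.

Definition durfee_rect (la : seq nat) : nat :=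
  \max_(1 <= i < (size la).+1 | i.+1 <= part la i) i.

Definition rank (la : seq nat) (i : nat) : int :=
  ((part la i)%:Z - (conj_part la i)%:Z)%R.

(* The parameters are integers.  No explicit nonnegativity condition is needed:
   size la, part la 1 and sumn la are natural numbers, so the set is empty as
   soon as m, n or N is negative. *)
Definition Pbox (m n N : int) : pred (seq nat) := fun la =>
  [&& is_partition la,
      ((size la)%:Z <= m)%R,
      ((part la 1)%:Z <= n)%R
    & (sumn la)%:Z%R == N].

Definition Rbar (b : int) : pred (seq nat) := fun la =>
  is_partition la && has (fun i => (rank la i < b)%R) (iota 1 (durfee la)).

Definition Rbar_box (b m n N : int) : pred (seq nat) :=
  [predI Rbar b & Pbox m n N].

Definition min_rank_index (la : seq nat) : nat :=
  \max_(1 <= i < (durfee la).+1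
         | all (fun j => (rank la i <= rank la j)%R) (iota 1 (durfee la))) i.

Definition add_part (k : nat) (la : seq nat) : seq nat :=
  if k == 0 then la else sort geq (k :: la).

(* The partial map f, undefined (None) outside Rbar 1. *)
Definition f (la : seq nat) : option (seq nat) :=
  if Rbar 1%R la then
    let i := min_rank_index la in
    Some (conjugate (add_part i.-1 (conjugate (rem i la))))
  else None.

(* The k-fold iterate is defined at la only if every intermediate iterate lies
   in the domain of f. *)
Definition f_iter (k : nat) (la : seq nat) : option (seq nat) :=
  iter k (obind f) (Some la).

(* The partial map F is defined on all of A and restricts to a bijection
   from A onto B. *)
Definition pbijection (T U : Type) (F : T -> option U)
    (A : pred T) (B : pred U) : Prop :=
  [/\ forall x, A x -> exists2 y, B y & F x = Some y,
      forall x1 x2, A x1 -> A x2 -> F x1 = F x2 -> x1 = x2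
    & forall y, B y -> exists2 x, A x & F x = Some y].

Definition preserves (T : Type) (V : Type) (F : T -> option T)
    (A : pred T) (stat : T -> V) : Prop :=
  forall x y, A x -> F x = Some y -> stat y = stat x.

(* Main.v *)
Require Import Defs.
From mathcomp Require Import all_boot all_order all_algebra.
From mathcomp Require Import zify.
Import Order.TTheory GRing.Theory Num.Theory.

(* Let t be the height of the Durfee rectangle.  A partition is determined by t,
   by its first t rows (right of the t x (t+1) rectangle) and by its first t+1
   columns (below it).  Let e_j be the j-th column minus the j-th row for
   j <= t, and let e_(t+1) be the (t+1)-st column minus t+1, so that e_j = -r_j
   for j <= d and e_(t+1) = -1 if d = t.
   If i is the last index maximizing e, then f fixes t, lengthens the rows j < i
   by 1 and shortens the columns j <= i by 1.  Hence e_j drops by 2 for j < i,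
   by 1 for j = i and by 0 for j > i: the maximum drops by exactly 1, and i is
   now the first index maximizing e, which makes f invertible as long as
   max e >= 0 beforehand.  Iterating lowers the bound on max e by 1 at each step,
   and max e >= -1 is no condition at all.  The assumption on m, n, l is needed
   only in the inverse step with i = 1, which does not shorten the first row. *)

(** * Thresholds and maxima over integer ranges *)

Lemma eq_leq_pos (a b : nat) : (forall k, 0 < k -> (k <= a) = (k <= b)) -> a = b.
Proof.
move=> h; have := h a; have := h b; rewrite !leqnn; lia.
Qed.

Lemma bigmax_nat_id_spec (P : pred nat) (n k : nat) : 0 < k <= n -> P k ->
  let M := \max_(1 <= i < n.+1 | P i) i in
  [/\ 0 < M <= n, P M & forall j, 0 < j <= n -> P j -> j <= M].
Proof.
elim: n k => [|n IHn] k; first lia.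
move=> hk Pk M; rewrite {}/M big_mkcond big_nat_recr //= -big_mkcond /=.
case: ifP => [Pn|nPn].
  have -> : maxn (\max_(1 <= i < n.+1 | P i) i) n.+1 = n.+1.
    apply/maxn_idPr; rewrite big_nat_cond.
    by apply/bigmax_leqP_seq => i _; lia.
  by split=> // [|j]; lia.
have kn : k != n.+1 by apply: contraFneq nPn => <-.
have [|h1 h2 h3] := IHn k _ Pk; first lia.
rewrite maxn0; split=> // [|j hj Pj]; first lia.
have jn : j != n.+1 by apply: contraFneq nPn => <-.
by apply: h3 => //; lia.
Qed.

(** Made for [durfee] and [durfee_rect], whose conditions are downward closed and bound the index by
    the number of parts. *)
Lemma leq_bigmax_nat_id (P : pred nat) (n k : nat) :
    (forall i j, 0 < i <= j -> P j -> P i) -> (forall j, P j -> j <= n) ->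
  0 < k -> (k <= \max_(1 <= i < n.+1 | P i) i) = P k.
Proof.
move=> Pdown Pn k0; apply/idP/idP => [|Pk]; last first.
  have [|_ _ h] := @bigmax_nat_id_spec P n k _ Pk; first by rewrite k0 Pn.
  by apply: h => //; rewrite k0 Pn.
case: (boolP (has P (iota 1 n))) => [/hasP[i]|/hasPn nP].
  rewrite mem_iota => hi Pi; have [|_ PM _ le_kM] := @bigmax_nat_id_spec P n i _ Pi.
    lia.
  by apply: Pdown PM; rewrite k0.
rewrite big_nat_cond big1 ?leqn0 => [|i /andP[hi Pi]]; first lia.
by have := nP i; rewrite mem_iota Pi => /(_ ltac:(lia)).
Qed.

Lemma exists_first_max (F : nat -> int) (n : nat) :
  exists2 i, 0 < i <= n.+1 & (forall j, 0 < j <= n.+1 -> (F j <= F i)%R) /\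
                             (forall j, 0 < j < i -> (F j < F i)%R).
Proof.
elim: n => [|n [i hi [hmax hfirst]]].
  by exists 1 => //; split=> j hj; [have -> : j = 1 by lia | lia].
case: (lerP (F n.+2) (F i)) => h; [exists i | exists n.+2]; try lia.
  split=> // j hj; case: (eqVneq j n.+2) => [-> //|hj2]; apply: hmax; lia.
split=> j hj; last by apply: le_lt_trans h; apply: hmax; lia.
case: (eqVneq j n.+2) => [-> //|hj2]; apply: ltW; apply: le_lt_trans h.
apply: hmax; lia.
Qed.

(** * Rows, columns and conjugation *)

Lemma leq_conj_part (la : seq nat) (i j : nat) :
  is_partition la -> 0 < i -> 0 < j -> (i <= conj_part la j) = (j <= part la i).
Proof.
case/andP=> sla _; case: i => // i _ j0.
elim: la i sla => [|x s IHs] i /=; first by rewrite /part nth_nil; lia.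
move=> xs; have /= := IHs _ (path_sorted xs).
have {xs}/allP xs := order_path_min (fun y x z h1 h2 => leq_trans h2 h1) xs.
rewrite /conj_part /part /= => {}IHs.
case: (leqP j x) => jx.
  by case: i => [|i]; [rewrite jx | exact: IHs].
have -> : count (leq j) s = 0.
  apply/eqP; rewrite -leqn0 leqNgt -has_count; apply/hasPn=> y /xs /= yx.
  by rewrite -ltnNge (leq_ltn_trans yx).
suff : nth 0 (x :: s) i < j by case: i => /=; lia.
case: i => //= i; case: (ltnP i (size s)) => hi; last by rewrite nth_default.
by apply: leq_ltn_trans jx; apply: xs; rewrite mem_nth.
Qed.

Lemma conj_part1 (la : seq nat) : is_partition la -> conj_part la 1 = size la.
Proof. by case/andP=> _; rewrite all_count => /eqP. Qed.

Lemma conj_part_anti (la : seq nat) (i j : nat) :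
  i <= j -> conj_part la j <= conj_part la i.
Proof. by move=> ij; apply: sub_count => x /= /(leq_trans ij). Qed.

Lemma part_anti (la : seq nat) (i j : nat) :
  is_partition la -> 0 < i <= j -> part la j <= part la i.
Proof.
move=> pla /andP[i0 ij]; case: (posnP (part la j)) => [-> //|pj].
rewrite -leq_conj_part // (leq_trans ij) // leq_conj_part //; lia.
Qed.

Lemma eq_partition (la mu : seq nat) : is_partition la -> is_partition mu ->
  (forall j, 0 < j -> conj_part la j = conj_part mu j) -> la = mu.
Proof.
move=> pla pmu h; have hs : size la = size mu by rewrite -!conj_part1 ?h.
apply: (eq_from_nth (x0 := 0)) => // i _; apply: eq_leq_pos => k k0.
by have := @leq_conj_part la i.+1 k; have := @leq_conj_part mu i.+1 k;
   rewrite /part /= h // => -> // <-.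
Qed.

Lemma conjugate_partition (la : seq nat) :
  is_partition la -> is_partition (conjugate la).
Proof.
move=> pla; apply/andP; split.
  apply: (homo_sorted (e := leq)); first by move=> i j; exact: conj_part_anti.
  exact: iota_sorted.
apply/allP=> x /mapP[j]; rewrite mem_iota => hj ->.
by rewrite leq_conj_part //; lia.
Qed.

Lemma part_conjugate (la : seq nat) (j : nat) :
  is_partition la -> 0 < j -> part (conjugate la) j = conj_part la j.
Proof.
move=> pla j0; rewrite {1}/part; case: (leqP j (part la 1)) => hj.
  rewrite (nth_map 0) ?size_iota ?nth_iota; try lia.
  by congr conj_part; lia.
rewrite nth_default ?size_map ?size_iota; last lia.
by have := @leq_conj_part la 1 j pla isT j0; lia.
Qed.

Lemma conj_part_conjugate (la : seq nat) (j : nat) :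
  is_partition la -> 0 < j -> conj_part (conjugate la) j = part la j.
Proof.
move=> pla j0; apply: eq_leq_pos => k k0.
by rewrite leq_conj_part ?conjugate_partition // part_conjugate // leq_conj_part.
Qed.

Lemma sumn_conjugate (la : seq nat) :
  is_partition la -> sumn (conjugate la) = sumn la.
Proof.
move=> pla; rewrite !sumnE /conjugate big_map.
(* Count the cells twice: a part [x] contributes one cell to each of the columns [1] to [x]. *)
under eq_bigr => j _ do rewrite /conj_part -sum1_count big_mkcond /=.
rewrite exchange_big /= !big_seq; apply: eq_bigr => x xla.
have hx : x <= part la 1.
  have /(nthP 0)[i hi <-] := xla.
  exact: (@part_anti la 1 i.+1).
rewrite -big_mkcond /= sum1_count -size_filter.
rewrite -[RHS](size_iota 1); apply: perm_size; apply: uniq_perm.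
- by rewrite filter_uniq ?iota_uniq.
- exact: iota_uniq.
by move=> j; rewrite mem_filter !mem_iota; lia.
Qed.

(** The heights of columns [i] and [i.+1] differ by the multiplicity of [i] as a part. *)
Lemma mem_conj_part (la : seq nat) (i : nat) :
  conj_part la i.+1 < conj_part la i -> i \in la.
Proof.
apply: contraLR => ila; rewrite -leqNgt /conj_part.
apply: eq_leq; apply: eq_in_count => x xla /=.
by have : x != i by [apply: contraNneq ila => <-]; lia.
Qed.

(** * Removing and adding a part *)

Lemma rem_partition (la : seq nat) (i : nat) :
  is_partition la -> is_partition (rem i la).
Proof.
case/andP=> sla pla; apply/andP; split.
  apply: (subseq_sorted _ (rem_subseq _ _)) sla.
  by move=> y x z h1 h2; exact: leq_trans h2 h1.
by apply/allP=> x /mem_rem; apply: (allP pla).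
Qed.

Lemma conj_part_rem (la : seq nat) (i j : nat) :
  i \in la -> conj_part (rem i la) j = conj_part la j - (j <= i).
Proof. by move=> ila; rewrite /conj_part count_rem ila. Qed.

Lemma sumn_rem (la : seq nat) (i : nat) :
  i \in la -> sumn la = i + sumn (rem i la).
Proof. by move=> ila; rewrite (perm_sumn (perm_to_rem ila)). Qed.

Lemma add_part_partition (la : seq nat) (k : nat) :
  is_partition la -> is_partition (add_part k la).
Proof.
rewrite /add_part; case: posnP => // k0 /andP[_ pla]; apply/andP; split.
  by apply: sort_sorted => x y; exact: leq_total.
by rewrite all_sort /= k0.
Qed.

Lemma conj_part_add (la : seq nat) (k j : nat) :
  0 < j -> conj_part (add_part k la) j = conj_part la j + (j <= k).
Proof.
move=> j0; rewrite /add_part; case: posnP => k0; first lia.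
by rewrite /conj_part count_sort /= addnC.
Qed.

Lemma sumn_add_part (la : seq nat) (k : nat) :
  sumn (add_part k la) = k + sumn la.
Proof.
rewrite /add_part; case: posnP => [-> //|_].
have /perm_sumn -> : perm_eq (sort geq (k :: la)) (k :: la) by rewrite perm_sort.
by [].
Qed.

(** In the diagram, the deleted row can be taken to be the last one of length [i], which has index
    [conj_part la i]; the rows above it stay in place. *)
Lemma part_rem (la : seq nat) (i j : nat) : is_partition la -> i \in la ->
  0 < j < conj_part la i -> part (rem i la) j = part la j.
Proof.
move=> pla ila /andP[j0 hj]; apply: eq_leq_pos => k k0.
rewrite -!leq_conj_part ?rem_partition ?conj_part_rem //.
by case: (leqP k i) => [ki|]; first (have := conj_part_anti la k i ki); lia.
Qed.

Lemma part_rem_leq (la : seq nat) (i j : nat) : is_partition la ->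
  0 < j -> part (rem i la) j <= part la j.
Proof.
move=> pla j0; case: (posnP (part (rem i la) j)) => [-> //|p0].
rewrite -leq_conj_part //.
apply: leq_trans (_ : conj_part (rem i la) (part (rem i la) j) <= _).
  by rewrite leq_conj_part ?rem_partition.
exact: leq_count_subseq (rem_subseq _ _).
Qed.

Lemma part_add (la : seq nat) (i j : nat) : is_partition la ->
  0 < j <= conj_part la i -> part (add_part i la) j = part la j.
Proof.
move=> pla /andP[j0 hj]; apply: eq_leq_pos => k k0.
rewrite -!leq_conj_part ?add_part_partition ?conj_part_add //.
by case: (leqP k i) => [ki|]; first (have := conj_part_anti la k i ki); lia.
Qed.

(** * Durfee square and Durfee rectangle *)

Lemma leq_durfee (la : seq nat) (i : nat) :
  is_partition la -> 0 < i -> (i <= durfee la) = (i <= part la i).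
Proof.
move=> pla i0; apply: leq_bigmax_nat_id => // [j k jk|j]; last first.
  case: j => // j; rewrite -leq_conj_part // => /leq_trans; apply.
  exact: count_size.
by have := @part_anti la j k pla jk; lia.
Qed.

Lemma leq_durfee_rect (la : seq nat) (i : nat) :
  is_partition la -> 0 < i -> (i <= durfee_rect la) = (i < part la i).
Proof.
move=> pla i0; apply: (@leq_bigmax_nat_id (fun i => i < part la i)) => // [j k jk|j].
  by have := @part_anti la j k pla jk; lia.
case: j => // j; rewrite -leq_conj_part // => /leq_trans; apply.
exact: count_size.
Qed.

(** The case [t = 0] stands apart because [part la 0] reads the first part, which is 0 for the empty
    partition. *)
Lemma durfee_rectP (la : seq nat) (t : nat) : is_partition la ->
  (t = 0 \/ t < part la t) -> part la t.+1 <= t.+1 -> durfee_rect la = t.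
Proof.
move=> pla ht ht1; apply: eq_leq_pos => k k0; rewrite leq_durfee_rect //.
case: (leqP k t) => kt.
  by case: ht => [|ht]; [|have := @part_anti la k t pla]; lia.
by have := @part_anti la t.+1 k pla; lia.
Qed.

Lemma part_durfee_rect (la : seq nat) (j : nat) : is_partition la ->
  0 < j <= durfee_rect la -> durfee_rect la < part la j.
Proof.
move=> pla hj; have := @leq_durfee_rect la (durfee_rect la) pla.
by have := @part_anti la j (durfee_rect la) pla; lia.
Qed.

Lemma part_durfee_rectS (la : seq nat) (j : nat) : is_partition la ->
  durfee_rect la < j -> part la j <= (durfee_rect la).+1.
Proof.
move=> pla hj; have := @leq_durfee_rect la (durfee_rect la).+1 pla isT.
by have := @part_anti la (durfee_rect la).+1 j pla; lia.
Qed.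

(** Rows below the Durfee rectangle have length at most t+1, so the square has side at most t+1,
    attained when column t+1 reaches row t+1. *)
Lemma durfeeE (la : seq nat) : is_partition la ->
  durfee la = durfee_rect la + (durfee_rect la < conj_part la (durfee_rect la).+1).
Proof.
move=> pla; rewrite leq_conj_part //; apply: eq_leq_pos => k k0.
rewrite leq_durfee //; have := @part_durfee_rectS la k pla.
have := @part_durfee_rect la k pla.
by case: (eqVneq k (durfee_rect la).+1) => [->|]; lia.
Qed.

(* With t the height of the Durfee rectangle, [arm la j] for 1 <= j <= t+1 is
   the j-th part, except that arm la (t+1) = t+1 even when the (t+1)-st part is
   smaller.  The partition is determined by t, the arms and the first t+1
   column heights. *)
Definition arm (la : seq nat) (j : nat) : nat :=
  maxn (part la j) (durfee_rect la).+1.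

(* [excess la j] is minus the j-th rank for j <= durfee la, and equals -1 for
   j = t+1 when the Durfee square has side t. *)
Definition excess (la : seq nat) (j : nat) : int :=
  ((conj_part la j)%:Z - (arm la j)%:Z)%R.

(** * Extremal indices of the excess, and a single step in coordinates *)

Definition last_max_excess (la : seq nat) (i : nat) : Prop :=
  [/\ 0 < i <= (durfee_rect la).+1,
      forall j, 0 < j <= i -> (excess la j <= excess la i)%R
    & forall j, i < j <= (durfee_rect la).+1 -> (excess la j < excess la i)%R].

Definition first_max_excess (la : seq nat) (i : nat) : Prop :=
  [/\ 0 < i <= (durfee_rect la).+1,
      forall j, 0 < j < i -> (excess la j < excess la i)%R
    & forall j, i <= j <= (durfee_rect la).+1 -> (excess la j <= excess la i)%R].

(** A relation rather than a function, so that a step can be read in both directions. *)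
Definition dyson_step (i : nat) (la mu : seq nat) : Prop :=
  durfee_rect mu = durfee_rect la /\
  forall j, 0 < j <= (durfee_rect la).+1 ->
    arm mu j = arm la j + (j < i) /\ conj_part la j = conj_part mu j + (j <= i).

Lemma arm_durfee_rect (la : seq nat) (j : nat) : is_partition la ->
  0 < j <= durfee_rect la -> arm la j = part la j.
Proof. by move=> pla hj; apply/maxn_idPl/part_durfee_rect. Qed.

Lemma arm_durfee_rectS (la : seq nat) : is_partition la ->
  arm la (durfee_rect la).+1 = (durfee_rect la).+1.
Proof. by move=> pla; apply/maxn_idPr/part_durfee_rectS. Qed.

Lemma arm_anti (la : seq nat) (i j : nat) :
  is_partition la -> 0 < i <= j -> arm la j <= arm la i.
Proof. by move=> pla /(@part_anti la i j pla); rewrite /arm; lia. Qed.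

(** Columns beyond the (t+1)-st only meet the first t rows, since the lower rows have length at most
    t+1. *)
Lemma eq_partition_arm (la mu : seq nat) : is_partition la -> is_partition mu ->
    durfee_rect la = durfee_rect mu ->
    (forall j, 0 < j <= (durfee_rect la).+1 ->
       arm la j = arm mu j /\ conj_part la j = conj_part mu j) ->
  la = mu.
Proof.
move=> pla pmu ht h; apply: eq_partition => // j j0.
case: (leqP j (durfee_rect la).+1) => hj.
  by have [|_ ->] := h j; rewrite ?j0.
apply: eq_leq_pos => k k0; rewrite !leq_conj_part //.
case: (leqP k (durfee_rect la)) => hk.
  by have [|] := h k; rewrite ?arm_durfee_rect -?ht ?k0 ?(leqW hk) // => ->.
by have := @part_durfee_rectS la k pla; have := @part_durfee_rectS mu k pmu; lia.
Qed.

Lemma excess_step (i : nat) (la mu : seq nat) (j : nat) : dyson_step i la mu ->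
  0 < j <= (durfee_rect la).+1 ->
  excess la j = (excess mu j + (j < i)%:Z + (j <= i)%:Z)%R.
Proof. by case=> _ h /h; rewrite /excess; lia. Qed.

(** Compared with the excess at [i], earlier ones drop by one more and later ones by one less, so
    over the integers weak and strict inequalities trade places. *)
Lemma dyson_step_max (i : nat) (la mu : seq nat) : dyson_step i la mu ->
  last_max_excess la i <-> first_max_excess mu i.
Proof.
move=> st; have [ht _] := st; have E := @excess_step i la mu _ st.
rewrite /last_max_excess /first_max_excess ht.
split=> -[hi h1 h2]; split=> // j hj; have := E i hi; have := E j ltac:(lia).
- by have := h1 j ltac:(lia); lia.
- case: (eqVneq j i) => [-> //|ji].
  by have := h2 j ltac:(lia); lia.
- case: (eqVneq j i) => [-> //|ji].
  by have := h1 j ltac:(lia); lia.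
by have := h2 j ltac:(lia); lia.
Qed.

Lemma first_max_excess_uniq (la : seq nat) (i j : nat) :
  first_max_excess la i -> first_max_excess la j -> i = j.
Proof.
move=> [hi i1 i2] [hj j1 j2]; case: (ltngtP i j) => // ij.
  by have := j1 i ltac:(lia); have := i2 j ltac:(lia); lia.
by have := i1 j ltac:(lia); have := j2 i ltac:(lia); lia.
Qed.

Lemma exists_first_max_excess (la : seq nat) : exists i, first_max_excess la i.
Proof.
have [i hi [h1 h2]] := exists_first_max (excess la) (durfee_rect la).
by exists i; split=> // j hj; apply: h1; lia.
Qed.

(** Column t+1 meets all t rows of the Durfee rectangle. *)
Lemma excess_durfee_rectS (la : seq nat) : is_partition la ->
  (-1 <= excess la (durfee_rect la).+1)%R.
Proof.
move=> pla; rewrite /excess arm_durfee_rectS //.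
case: (posnP (durfee_rect la)) => t0; first lia.
have := @leq_conj_part la (durfee_rect la) (durfee_rect la).+1 pla t0 isT.
by rewrite part_durfee_rect //; lia.
Qed.

(** * Ranks in terms of excesses *)

Lemma rank_excess (la : seq nat) (j : nat) : is_partition la ->
  0 < j <= durfee la -> rank la j = (- excess la j)%R.
Proof.
move=> pla /andP[j0 hj]; rewrite /excess /rank opprB; congr (_ - _)%R; congr Posz.
case: (leqP j (durfee_rect la)) => hj2; first by rewrite arm_durfee_rect ?j0.
(* Beyond the rectangle only index t+1 is left, and there the square forces a row of length exactly
   t+1, the value of the arm. *)
have hjE : j = (durfee_rect la).+1 by move: hj; rewrite durfeeE //; lia.
rewrite {2}hjE arm_durfee_rectS //; move: hj; rewrite leq_durfee //.
by have := @part_durfee_rectS la j pla hj2; lia.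
Qed.

Lemma leq_durfee_excess (la : seq nat) (j : nat) : is_partition la ->
  0 < j <= (durfee_rect la).+1 -> (0 <= excess la j)%R -> j <= durfee la.
Proof.
move=> pla hj; rewrite durfeeE //; case: (leqP j (durfee_rect la)); first lia.
move=> hj2; have -> : j = (durfee_rect la).+1 by lia.
by rewrite /excess arm_durfee_rectS //; lia.
Qed.

(** Since [l] is nonnegative, an index whose excess is at least [l] lies in the Durfee square, so
    its excess is minus a genuine rank. *)
Lemma Rbar_excess (l : nat) (la : seq nat) : is_partition la ->
  Rbar (1 - l%:Z)%R la <->
  exists2 j, 0 < j <= (durfee_rect la).+1 & (l%:Z <= excess la j)%R.
Proof.
move=> pla; rewrite /Rbar pla; split=> [/hasP[j]|[j hj hl]].
  rewrite mem_iota => hj; rewrite rank_excess //.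
  by move=> hl; exists j; [move: hj; rewrite durfeeE //|]; lia.
have hd := @leq_durfee_excess la j pla hj ltac:(lia).
apply/hasP; exists j; first by rewrite mem_iota; lia.
by rewrite rank_excess //; lia.
Qed.

(** * The map [f] as a step, and the inverse step *)

Lemma min_rank_index_spec (la : seq nat) : Rbar 1%R la ->
  last_max_excess la (min_rank_index la) /\
  (0 <= excess la (min_rank_index la))%R.
Proof.
move=> /[dup] Rla /andP[pla _].
have [k hk k0] := (@Rbar_excess 0 la pla).1 ltac:(rewrite subr0; exact: Rla).
have kd := @leq_durfee_excess la k pla hk k0.
have dt : durfee la <= (durfee_rect la).+1 by rewrite durfeeE //; lia.
pose P i := all (fun j => (rank la i <= rank la j)%R) (iota 1 (durfee la)).
have PE i : 0 < i <= durfee la ->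
    P i <-> forall j, 0 < j <= durfee la -> (excess la j <= excess la i)%R.
  move=> hi; split=> [/allP h j hj|h].
    have := h j ltac:(rewrite mem_iota; lia).
    by rewrite !rank_excess //; lia.
  apply/allP => j; rewrite mem_iota => hj; rewrite !rank_excess //; try lia.
  by have := h j ltac:(lia); lia.
have [i0 hi0 [/= hmax _]] := exists_first_max (excess la) (durfee la).-1.
have [| |hM /PE PM hlast] := @bigmax_nat_id_spec P (durfee la) i0.
- lia.
- by apply/PE => [|j hj]; [|apply: hmax]; lia.
rewrite -[\max_(_ <= i < _ | _) _]/(min_rank_index la) in hM PM hlast *.
set i := min_rank_index la in hM PM hlast *.
have {}PM := PM hM.
have i_ge0 : (0 <= excess la i)%R by have := PM k ltac:(lia); lia.
split=> //; split=> [|j hj|j hj]; [lia|by apply: PM; lia|].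
(* A later index with an excess at least as large would lie in the Durfee square and also minimize
   the rank, against the choice of [i]. *)
rewrite ltNge; apply/negP => le_ij.
have jd := @leq_durfee_excess la j pla ltac:(lia) (le_trans i_ge0 le_ij).
suff /hlast : P j by lia.
by apply/PE => [|k' hk']; [lia|apply: le_trans le_ij; apply: PM; lia].
Qed.

(* The deleted row lies below the Durfee rectangle, and the inserted column to
   its right, so no part inside the coordinates is displaced. *)
Lemma dyson_step_forward (la : seq nat) (i : nat) : is_partition la ->
    last_max_excess la i -> (0 <= excess la i)%R ->
  let mu := conjugate (add_part i.-1 (conjugate (rem i la))) in
  [/\ is_partition mu, dyson_step i la mu & sumn la = (sumn mu).+1].
Proof.
move=> pla [hi h1 h2] i_ge0 mu; set t := durfee_rect la in hi h2 *.
have q_i : t < conj_part la i.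
  by move: i_ge0; rewrite /excess /arm -/t; lia.
have ila : i \in la.
  (* For [i <= t] the excess drops from [i] to [i.+1] while the arm does not grow, so the column
     shrinks. For [i = t.+1] column [i] reaches row [t.+1] but column [i.+1] does not. *)
  apply: mem_conj_part; case: (leqP i t) => it.
    have := h2 i.+1 ltac:(lia); have := @arm_anti la i i.+1 pla ltac:(lia).
    by rewrite /excess; lia.
  have iE : i = t.+1 by lia.
  have := @part_durfee_rectS la t.+1 pla (leqnn _); rewrite -/t -iE.
  by have := @leq_conj_part la i i.+1 pla ltac:(lia) isT; lia.
pose nu := rem i la; have pnu : is_partition nu by exact: rem_partition.
have pcnu := conjugate_partition nu pnu.
have paux := add_part_partition (conjugate nu) i.-1 pcnu.
have pmu : is_partition mu by exact: conjugate_partition.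
have part_mu j : 0 < j -> part mu j = part nu j + (j < i).
  move=> j0; rewrite /mu part_conjugate // conj_part_add //.
  by rewrite conj_part_conjugate // -/nu; lia.
have part_nu j : 0 < j <= t -> part nu j = part la j.
  by move=> hj; rewrite part_rem //; lia.
have conj_mu j : 0 < j <= t.+1 -> conj_part mu j = conj_part nu j.
  move=> hj; rewrite conj_part_conjugate //; last lia.
  rewrite /add_part; case: eqP => i1; first by rewrite part_conjugate //; lia.
  have := part_add (conjugate nu) i.-1 j pcnu.
  rewrite /add_part; case: eqP => // _ ->; rewrite ?part_conjugate //; first lia.
  rewrite conj_part_conjugate //; last lia.
  (* Row [i.-1] has length more than [t], so the new column goes to the right of column [t.+1]. *)
  have := @part_durfee_rect la i.-1 pla ltac:(lia).
  by rewrite part_nu -/t; lia.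
have ht : durfee_rect mu = t.
  apply: durfee_rectP => //.
    case: (posnP t) => t0; [by left | right; rewrite part_mu // part_nu; last lia].
    by have := @part_durfee_rect la t pla; rewrite -/t; lia.
  rewrite part_mu // ltnNge (_ : i <= t.+1) ?addn0; last lia.
  apply: leq_trans (part_rem_leq la i t.+1 pla isT) _.
  exact: part_durfee_rectS.
split=> //; last first.
  have := sumn_rem la i ila; rewrite /mu sumn_conjugate // sumn_add_part.
  by rewrite sumn_conjugate // -/nu; lia.
split=> // j hj; split; last first.
  rewrite conj_mu // conj_part_rem //.
  by case: (leqP j i) => ji; [have := conj_part_anti la j i ji|]; lia.
case: (leqP j t) => jt.
  by rewrite !arm_durfee_rect -/t ?ht ?part_mu ?part_nu //; lia.
have -> : j = t.+1 by lia.
by rewrite arm_durfee_rectS // -{1}ht arm_durfee_rectS // ht; lia.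
Qed.

(** Undo the step in reverse order: delete a column of height [i.-1] if [i > 1], then insert a row
    of length [i]. As the excess rises strictly from [i.-1] to [i] while the column does not grow,
    row [i.-1] is longer than arm [i]; this yields the column to delete, to the right of column
    t+1. *)
Lemma dyson_step_backward (mu : seq nat) (i : nat) : is_partition mu ->
    first_max_excess mu i ->
  exists2 la, is_partition la & dyson_step i la mu.
Proof.
move=> pmu [hi h1 h2]; set t := durfee_rect mu in hi h2 *.
have part_i : 1 < i -> t.+1 < part mu i.-1 /\ i.-1 \in conjugate mu.
  move=> i1; have := h1 i.-1 ltac:(lia); rewrite /excess.
  have := conj_part_anti mu i.-1 i ltac:(lia).
  rewrite (@arm_durfee_rect mu i.-1) // -?/t; last lia.
  rewrite /arm -/t => hq harm; split; first lia.
  apply: mem_conj_part; rewrite !conj_part_conjugate //; try lia.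
  by rewrite (_ : i.-1.+1 = i); lia.
have pcmu := conjugate_partition mu pmu.
pose ka := rem i.-1 (conjugate mu).
have pka : is_partition ka by exact: rem_partition.
have conj_ka j : 0 < j -> conj_part ka j = part mu j - (j < i).
  move=> j0; rewrite /ka; case: (ltnP 1 i) => i1.
    have [_ hmem] := part_i i1.
    by rewrite conj_part_rem // conj_part_conjugate //; lia.
  (* For [i = 1], 0 is not a part of the conjugate, so [rem] changes nothing. *)
  rewrite rem_id ?conj_part_conjugate //; first lia.
  have -> : i.-1 = 0 by lia.
  by apply/negP => /(allP (proj2 (andP pcmu))).
have part_ka j : 0 < j <= t.+1 -> part ka j = conj_part mu j.
  move=> hj; rewrite /ka; case: (ltnP 1 i) => i1.
    have [hp hmem] := part_i i1.
    by rewrite part_rem ?part_conjugate // ?conj_part_conjugate //; lia.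
  rewrite rem_id ?part_conjugate //; first lia.
  have -> : i.-1 = 0 by lia.
  by apply/negP => /(allP (proj2 (andP pcmu))).
pose nu := conjugate ka; have pnu : is_partition nu by exact: conjugate_partition.
pose la := add_part i nu.
have pla : is_partition la by exact: add_part_partition.
have conj_la j : 0 < j -> conj_part la j = part ka j + (j <= i).
  by move=> j0; rewrite conj_part_add // conj_part_conjugate.
have t_le j : 0 < j <= t.+1 -> t <= conj_part mu j.
  move=> hj; case: (posnP t) => [-> //|t0].
  rewrite leq_conj_part //; last lia.
  by have := @part_durfee_rect mu t pmu; rewrite -/t; lia.
have part_la j : 0 < j <= t -> part la j = part mu j - (j < i).
  move=> hj; rewrite part_add ?part_conjugate ?conj_ka //; try lia.
  rewrite conj_part_conjugate ?part_ka //; try lia.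
  by have := t_le i; lia.
have ht : durfee_rect la = t.
  apply: durfee_rectP => //.
    case: (posnP t) => t0; [by left | right; rewrite part_la; last lia].
    have := @part_durfee_rect mu t pmu; rewrite -/t.
    (* Row [t] loses a cell only when [i = t.+1], and then its length was at least [t.+2]. *)
    case: (ltnP t i) => ti; last lia.
    have [|hp _] := part_i; first lia.
    by rewrite (_ : i.-1 = t) in hp; lia.
  rewrite leqNgt -leq_conj_part // conj_la // -ltnNge ltnS.
  rewrite (_ : t.+2 <= i = false) ?addn0; last lia.
  apply: leq_trans (part_rem_leq (conjugate mu) i.-1 t.+2 pcmu isT) _.
  rewrite part_conjugate // -ltnS ltnNge leq_conj_part // -ltnNge ltnS.
  exact: part_durfee_rectS.
exists la => //; split=> [|j]; rewrite ht // => hj; split; last first.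
  by rewrite conj_la ?part_ka //; lia.
case: (leqP j t) => jt.
  rewrite !arm_durfee_rect -/t ?ht ?part_la //; try lia.
  by have := @part_durfee_rect mu j pmu; rewrite -/t; lia.
have -> : j = t.+1 by lia.
have := arm_durfee_rectS mu pmu; have := arm_durfee_rectS la pla.
by rewrite ht -/t => -> ->; lia.
Qed.

Lemma last_max_excess_uniq (la : seq nat) (i j : nat) :
  last_max_excess la i -> last_max_excess la j -> i = j.
Proof.
move=> [hi i1 i2] [hj j1 j2]; case: (ltngtP i j) => // ij.
  by have := i2 j ltac:(lia); have := j1 i ltac:(lia); lia.
by have := i1 j ltac:(lia); have := j2 i ltac:(lia); lia.
Qed.

Lemma dyson_step_inj (i : nat) (la1 la2 mu : seq nat) :
    is_partition la1 -> is_partition la2 ->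
    dyson_step i la1 mu -> dyson_step i la2 mu ->
  la1 = la2.
Proof.
move=> p1 p2 [t1 h1] [t2 h2].
apply: eq_partition_arm => // [|j hj]; first by rewrite -t1 -t2.
by have := h1 j hj; have := h2 j; rewrite -t2 t1 => /(_ hj); lia.
Qed.

Lemma dyson_step_fun (i : nat) (la mu1 mu2 : seq nat) :
    is_partition mu1 -> is_partition mu2 ->
    dyson_step i la mu1 -> dyson_step i la mu2 ->
  mu1 = mu2.
Proof.
move=> p1 p2 [t1 h1] [t2 h2].
apply: eq_partition_arm => // [|j hj]; first by rewrite t1 t2.
by rewrite t1 in hj; have := h1 j hj; have := h2 j hj; lia.
Qed.

Lemma f_step (la : seq nat) : Rbar 1%R la -> exists mu i,
  [/\ f la = Some mu, last_max_excess la i & (0 <= excess la i)%R] /\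
  [/\ is_partition mu, dyson_step i la mu & sumn la = (sumn mu).+1].
Proof.
move=> Rla; have [imax i_ge0] := min_rank_index_spec la Rla.
have /andP[pla _] := Rla; have [p st hs] := dyson_step_forward la _ pla imax i_ge0.
by do 2!eexists; split; [split; [by rewrite /f Rla | exact: imax | ] | split; eauto].
Qed.

(* Uniform notation for the successive domains: the largest excess of a
   partition is always at least -1, so no condition remains for c = 0. *)
Definition excess_box (c : nat) (m n N : int) : pred (seq nat) :=
  if c is l.+1 then Rbar_box (1 - l%:Z)%R m n N else Pbox m n N.

(** * The successive domains as bounds on the maximal excess *)

Lemma excess_boxE (c : nat) (m n N : int) (la : seq nat) (i : nat) :
    0 < i <= (durfee_rect la).+1 ->
    (forall j, 0 < j <= (durfee_rect la).+1 -> (excess la j <= excess la i)%R) ->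
  excess_box c m n N la <-> Pbox m n N la /\ (c%:Z - 1 <= excess la i)%R.
Proof.
move=> hi hmax; case: c => [|l] /=.
  split=> [|[]] // Pla; split=> //.
  have /and4P[pla _ _ _] := Pla.
  by have := hmax (durfee_rect la).+1 ltac:(lia); have := excess_durfee_rectS la pla; lia.
have -> : (l.+1%:Z - 1 = l%:Z)%R by lia.
split=> [/andP[Rla Pla]|[Pla hl]].
  have pla : is_partition la by case/and4P: Pla.
  have [j hj hl] := (Rbar_excess l la pla).1 Rla.
  by split=> //; apply: le_trans hl (hmax j hj).
have pla : is_partition la by case/and4P: Pla.
by apply/andP; split=> //; apply/(Rbar_excess l la pla); exists i.
Qed.

Lemma excess_box_last (c : nat) (m n N : int) (la : seq nat) (i : nat) :
    last_max_excess la i ->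
  excess_box c m n N la <-> Pbox m n N la /\ (c%:Z - 1 <= excess la i)%R.
Proof.
case=> hi h1 h2; apply: excess_boxE => // j hj.
by case: (leqP j i) => ji; [apply: h1 | apply/ltW/h2]; lia.
Qed.

Lemma excess_box_first (c : nat) (m n N : int) (la : seq nat) (i : nat) :
    first_max_excess la i ->
  excess_box c m n N la <-> Pbox m n N la /\ (c%:Z - 1 <= excess la i)%R.
Proof.
case=> hi h1 h2; apply: excess_boxE => // j hj.
by case: (leqP i j) => ji; [apply: h2 | apply/ltW/h1]; lia.
Qed.

Lemma excess_box_Rbar1 (c : nat) (m n N : int) (la : seq nat) :
  excess_box c.+1 m n N la -> Rbar 1%R la.
Proof.
case/andP => /[dup] /andP[pla _] /(Rbar_excess _ _ pla)[j hj hc] _.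
have := (@Rbar_excess 0 la pla).2; rewrite subr0; apply.
by exists j => //; lia.
Qed.

(** * One application of [f] between consecutive domains *)

Lemma dyson_step_size (i : nat) (la mu : seq nat) :
    is_partition la -> is_partition mu -> 0 < i -> dyson_step i la mu ->
  size la = (size mu).+1.
Proof. by move=> pla pmu i0 [_ /(_ 1 isT)[_]]; rewrite !conj_part1 //; lia. Qed.

(** For t > 0 the first arm is the first row. For t = 0 the index is at most 1 and the first row of
    [mu] has length at most 1. *)
Lemma dyson_step_part1 (i : nat) (la mu : seq nat) :
    is_partition la -> is_partition mu -> i <= (durfee_rect la).+1 ->
    dyson_step i la mu ->
  part mu 1 <= (part la 1).+1 /\ (1 < i -> part mu 1 = (part la 1).+1).
Proof.
move=> pla pmu hi [ht /(_ 1 isT)[harm _]].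
case: (posnP (durfee_rect la)) => t0.
  by have := @part_durfee_rectS mu 1 pmu; lia.
by move: harm; rewrite !arm_durfee_rect //; lia.
Qed.

Lemma pbijection_f (c : nat) (m n N : int) : (m <= n + c%:Z)%R ->
  pbijection f (excess_box c.+1 m n N) (excess_box c (m - 1) (n + 1) (N - 1)).
Proof.
move=> hmn; split=> [la Qla|la1 la2 Q1 Q2|mu Qmu].
- have [mu [i [[fla imax _] [pmu st hN]]]] := f_step la (excess_box_Rbar1 _ _ _ _ _ Qla).
  exists mu => //; have /(excess_box_last _ _ _ _ _ _ imax)[Pla hc] := Qla.
  have /and4P[pla hm hn /eqP hNN] := Pla; have [hi _ _] := imax.
  apply/(excess_box_first _ _ _ _ _ i); first exact/(dyson_step_max _ _ _ st).
  split; last by have := excess_step i la mu i st hi; lia.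
  have [hp _] := dyson_step_part1 i la mu pla pmu ltac:(lia) st.
  have hs := dyson_step_size i la mu pla pmu ltac:(lia) st.
  by apply/and4P; split=> //; first [lia | apply/eqP; lia].
- have [mu [i1 [[-> max1 _] [pmu st1 _]]]] := f_step la1 (excess_box_Rbar1 _ _ _ _ _ Q1).
  have [mu2 [i2 [[-> max2 _] [_ st2 _]]]] := f_step la2 (excess_box_Rbar1 _ _ _ _ _ Q2).
  case=> eq_mu; rewrite -{mu2}eq_mu in st2.
  have /andP[/andP[p1 _] _] := Q1; have /andP[/andP[p2 _] _] := Q2.
  (* Both indices are recovered from the common image as its first maximum. *)
  have i12 : i1 = i2.
    apply: (@first_max_excess_uniq mu); first exact/(dyson_step_max _ la1).
    exact/(dyson_step_max _ la2).
  rewrite -{}i12 in st2 max2.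
  exact: dyson_step_inj st1 st2.
have [i imax] := exists_first_max_excess mu.
have /(excess_box_first _ _ _ _ _ _ imax)[Pmu hc] := Qmu.
have /and4P[pmu hm hn /eqP hN] := Pmu.
have [la pla st] := dyson_step_backward mu i pmu imax.
have lmax : last_max_excess la i by apply/(dyson_step_max _ _ _ st).
have [hi _ _] := lmax; have hE := excess_step i la mu i st hi.
have i_ge : (c%:Z <= excess la i)%R by lia.
have Rla : Rbar 1%R la.
  have := (@Rbar_excess 0 la pla).2; rewrite subr0; apply.
  by exists i => //; lia.
have [mu' [i' [[fla lmax' _] [pmu' st' hN']]]] := f_step la Rla.
rewrite {i' lmax'}(last_max_excess_uniq la i' i lmax' lmax) in st'.
have eq_mu := dyson_step_fun i la mu' mu pmu' pmu st' st.
rewrite {mu' st' pmu'}eq_mu in fla hN'; exists la => //.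
apply/(excess_box_last _ _ _ _ _ i lmax); split; last by lia.
have [_ hp] := dyson_step_part1 i la mu pla pmu ltac:(lia) st.
have hs := dyson_step_size i la mu pla pmu ltac:(lia) st.
(* If [i = 1], the bound on [part mu 1] is too weak by one; instead the first excess is at least
   [c], so the first row has length at most [m - c], hence at most [n]. *)
have part1 : ((part la 1)%:Z <= n)%R.
  case: (ltnP 1 i) => i1; first by have := hp i1; lia.
  have iE : i = 1 by lia.
  move: i_ge; rewrite iE /excess conj_part1 // /arm; lia.
by apply/and4P; split=> //; first [lia | apply/eqP; lia].
Qed.

(** The square can only shrink when [i] is t+1 and column t+1 loses its cell in row t+1; for [c > 0]
    that column had height at least t+2. *)
Lemma f_durfee (m n N : int) (c : nat) (la mu : seq nat) :
    excess_box c.+1 m n N la -> f la = Some mu ->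
  durfee_rect mu = durfee_rect la /\ (0 < c -> durfee mu = durfee la).
Proof.
move=> Qla fla.
have [mu' [i [[]]]] := f_step la (excess_box_Rbar1 _ _ _ _ _ Qla).
rewrite fla => -[<-] {mu'} imax _ [pmu st _].
have /(excess_box_last _ _ _ _ _ _ imax)[Pla hc] := Qla.
have pla : is_partition la by case/and4P: Pla.
have [ht h] := st; split=> // c0; rewrite !durfeeE // ht.
have [_ hq] := h (durfee_rect la).+1 ltac:(lia); have [hi _ _] := imax.
case: (ltnP (durfee_rect la) i) => ti; last lia.
have iE : i = (durfee_rect la).+1 by lia.
by move: hc; rewrite iE /excess arm_durfee_rectS //; lia.
Qed.

(** * Iteration of [f] *)

Lemma pbijection_comp (T U V : Type) (F : T -> option U) (G : U -> option V)
    (A : pred T) (B : pred U) (C : pred V) :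
  pbijection F A B -> pbijection G B C -> pbijection (fun x => obind G (F x)) A C.
Proof.
move=> [F1 F2 F3] [G1 G2 G3]; split=> [x /F1[y By ->]|x1 x2 A1 A2|z].
- by have [z Cz Gy] := G1 y By; exists z.
- have [y1 B1 E1] := F1 _ A1; have [y2 B2 E2] := F1 _ A2.
  rewrite E1 E2 => /(G2 _ _ B1 B2) ey; apply: F2 => //.
  by rewrite E1 E2 ey.
by case/G3 => y /F3[x Ax Fx] Gy; exists x; rewrite ?Fx.
Qed.

(** A step lowers [m] and the level by 1 and raises [n] by 1, so the inequality required for the
    first step implies those for the later ones. *)
Lemma pbijection_f_iter (k c : nat) (m n N : int) :
    (m + 1 <= n + (c + k)%:Z)%R ->
  pbijection (f_iter k) (excess_box (c + k) m n N)
    (excess_box c (m - k%:Z) (n + k%:Z) (N - k%:Z)).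
Proof.
elim: k c => [|k IHk] c hmn.
  have [-> -> ->] : [/\ m - 0%:Z = m, n + 0%:Z = n & N - 0%:Z = N]%R by split; lia.
  rewrite addn0; split=> [x Qx|x1 x2 _ _ [->] //|y Qy].
    by exists x.
  by exists y.
have fk := IHk c.+1 ltac:(lia).
have := pbijection_f c (m - k%:Z)%R (n + k%:Z)%R (N - k%:Z)%R ltac:(lia).
rewrite addSnnS in fk; move/(pbijection_comp _ _ _ _ _ _ _ _ fk).
by rewrite -!addrA -!opprD -(PoszD k 1) addn1.
Qed.

Lemma f_iter_durfee (k c : nat) (m n N : int) :
    (m + 1 <= n + (c + k)%:Z)%R ->
  preserves (f_iter k) (excess_box (c + k) m n N) durfee_rect /\
  (0 < c -> preserves (f_iter k) (excess_box (c + k) m n N) durfee).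
Proof.
elim: k c => [|k IHk] c hmn; first by split=> [x y _ [->]|_ x y _ [->]].
have [IHr IHd] := IHk c.+1 ltac:(lia).
have [fk _ _] := pbijection_f_iter k c.+1 m n N ltac:(lia).
rewrite addSnnS in IHr IHd fk.
by split=> [la nu Qla|c0 la nu Qla]; have [mu Qmu Emu] := fk la Qla;
  rewrite /f_iter iterS -/(f_iter k la) Emu /= => Enu;
  have [hr hd] := f_durfee _ _ _ c mu nu Qmu Enu;
  [rewrite hr; apply: IHr Qla Emu | rewrite hd //; apply: IHd Qla Emu].
Qed.

Theorem theorem5p4 (m n l N : nat) (hmnl : (m <= n + l)%N) :
  (pbijection (f_iter l.+1)
     (Rbar_box (1 - l%:Z)%R m%:Z%R n%:Z%R N%:Z%R)
     (Pbox (m%:Z - l%:Z - 1)%R (n%:Z + l%:Z + 1)%R (N%:Z - l%:Z - 1)%R)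
   /\ preserves (f_iter l.+1)
        (Rbar_box (1 - l%:Z)%R m%:Z%R n%:Z%R N%:Z%R) durfee_rect)
  /\
  [/\ pbijection (f_iter l)
        (Rbar_box (1 - l%:Z)%R m%:Z%R n%:Z%R N%:Z%R)
        (Rbar_box 1%R (m%:Z - l%:Z)%R (n%:Z + l%:Z)%R (N%:Z - l%:Z)%R),
      preserves (f_iter l)
        (Rbar_box (1 - l%:Z)%R m%:Z%R n%:Z%R N%:Z%R) durfee
    & preserves (f_iter l)
        (Rbar_box (1 - l%:Z)%R m%:Z%R n%:Z%R N%:Z%R) durfee_rect].
Proof.
(* Both parts start at level [l.+1]: (a) descends to level 0, the whole box, and (b) stops at level
   1, where some rank is below 1. *)
have ha : (m%:Z + 1 <= n%:Z + (0 + l.+1)%:Z)%R by lia.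
have hb : (m%:Z + 1 <= n%:Z + (1 + l)%:Z)%R by lia.
have [ra _] := f_iter_durfee _ _ _ _ N%:Z ha.
have [rb db] := f_iter_durfee _ _ _ _ N%:Z hb.
split; split=> //; last by apply: db.
  have := pbijection_f_iter _ _ _ _ N%:Z ha.
  by rewrite /= -addn1 PoszD !opprD !addrA.
by have := pbijection_f_iter _ _ _ _ N%:Z hb; rewrite /= subr0.
Qed.
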